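(* Let $I$ be an instance of Max d-KP on $n$ items that has an equivalent graph. Then $I$ can be solved (an optimal feasible solution can be computed) in time $O(n^{2d+1})$.
   Context: Max d-KP: an instance consists of a set $A=\{a_1,\ldots,a_n\}$ of $n$ items and a positive integer $d$ of dimensions. Each item $a_j$ has a non-negative real profit $p_j$ and, for each dimension $i\in\{1,\ldots,d\}$, a non-negative real size $s_{i,j}$. For each dimension $i$ there is a non-negative real capacity $c_i$. A subset $A'\subseteq A$ is a feasible solution if $\sum_{a_j\in A'}s_{i,j}\le c_i$ for all $i$. The task is to find a feasible solution maximizing $\sum_{a_j\in A'}p_j$. An instance $I$ and a finite simple graph $G=(V,E)$ are equivalent if there is a bijection $f:A\to V$ such that $A'\subseteq A$ is feasible for $I$ if and only if $f(A')$ is an independent set of $G$. *)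

(* Defs.v *)
From HB Require Import structures.
From mathcomp Require Import all_boot all_order all_algebra.
From mathcomp Require Import reals.

Set Implicit Arguments.
Unset Strict Implicit.
Unset Printing Implicit Defensive.

Import Order.TTheory GRing.Theory Num.Theory.
Local Open Scope ring_scope.

(* The items a_1, ..., a_n and the dimensions 1, ..., d are indexed from 0,
   by 'I_n and 'I_d. *)
Record mdkp (R : realType) (d n : nat) := MDKP {
  profit : 'I_n -> R;
  isize : 'I_d -> 'I_n -> R;
  capacity : 'I_d -> R;
  dim_gt0 : (0 < d)%N;
  profit_ge0 : forall j, 0 <= profit j;
  isize_ge0 : forall i j, 0 <= isize i j;
  capacity_ge0 : forall i, 0 <= capacity i }.

Definition feasible (R : realType) (d n : nat) (I : mdkp R d n)
    (A : {set 'I_n}) : Prop :=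
  forall i : 'I_d, \sum_(j in A) isize I i j <= capacity I i.

Definition total_profit (R : realType) (d n : nat) (I : mdkp R d n)
    (A : {set 'I_n}) : R := \sum_(j in A) profit I j.

Definition optimal (R : realType) (d n : nat) (I : mdkp R d n)
    (A : {set 'I_n}) : Prop :=
  feasible I A /\
  forall B : {set 'I_n}, feasible I B -> total_profit I B <= total_profit I A.

Record sgraph := SGraph {
  vertex : finType;
  edge : rel vertex;
  edge_sym : symmetric edge;
  edge_irr : irreflexive edge }.

Definition independent (G : sgraph) (S : {set vertex G}) : Prop :=
  forall x y, x \in S -> y \in S -> ~~ edge x y.

Definition equivalent (R : realType) (d n : nat) (I : mdkp R d n)
    (G : sgraph) : Prop :=
  exists f : 'I_n -> vertex G, bijective f /\
    forall A : {set 'I_n}, feasible I A <-> independent [set f x | x in A].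

Definition has_equivalent_graph (R : realType) (d n : nat)
    (I : mdkp R d n) : Prop := exists G : sgraph, equivalent I G.

(* Model of computation: a unit-cost real RAM, programmed in a structured
   while-language.  There are directly addressed integer and real registers
   (ireg, rreg) and indirectly addressed integer and real memories (imem, rmem),
   addressed through integer registers.  Integers and reals can only be added,
   subtracted (truncated, for integers) and compared, in unit time; there is no
   multiplication, no rounding and no conversion between reals and integers, so
   the model is a restriction of the usual real RAM. *)
Record state (R : realType) := State {
  ireg : nat -> nat;
  imem : nat -> nat;
  rreg : nat -> R;
  rmem : nat -> R }.

Inductive instr :=
  | ISet of nat & nat
  | IMove of nat & nat
  | IAdd of nat & nat & nat
  | ISub of nat & nat & nat
  | ILoad of nat & nat
  | IStore of nat & nat
  | RZero of nat
  | RMove of nat & nat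
  | RAdd of nat & nat & nat
  | RSub of nat & nat & nat
  | RLoad of nat & nat
  | RStore of nat & nat.

Inductive test :=
  | ILe of nat & nat
  | ILt of nat & nat
  | RLe of nat & nat
  | RLt of nat & nat.

Inductive cmd :=
  | Skip
  | Do of instr
  | Seq of cmd & cmd
  | If of test & cmd & cmd
  | While of test & cmd.

Definition upd (T : Type) (f : nat -> T) (k : nat) (v : T) : nat -> T :=
  fun m => if m == k then v else f m.

Definition set_ireg (R : realType) (s : state R) (x v : nat) : state R :=
  State (upd (ireg s) x v) (imem s) (rreg s) (rmem s).
Definition set_imem (R : realType) (s : state R) (a v : nat) : state R :=
  State (ireg s) (upd (imem s) a v) (rreg s) (rmem s).
Definition set_rreg (R : realType) (s : state R) (x : nat) (v : R) : state R :=
  State (ireg s) (imem s) (upd (rreg s) x v) (rmem s).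
Definition set_rmem (R : realType) (s : state R) (a : nat) (v : R) : state R :=
  State (ireg s) (imem s) (rreg s) (upd (rmem s) a v).

Definition run_instr (R : realType) (c : instr) (s : state R) : state R :=
  match c with
  | ISet x k => set_ireg s x k
  | IMove x y => set_ireg s x (ireg s y)
  | IAdd x y z => set_ireg s x (ireg s y + ireg s z)%N
  | ISub x y z => set_ireg s x (ireg s y - ireg s z)%N
  | ILoad x y => set_ireg s x (imem s (ireg s y))
  | IStore x y => set_imem s (ireg s x) (ireg s y)
  | RZero x => set_rreg s x 0
  | RMove x y => set_rreg s x (rreg s y)
  | RAdd x y z => set_rreg s x (rreg s y + rreg s z)
  | RSub x y z => set_rreg s x (rreg s y - rreg s z)
  | RLoad x y => set_rreg s x (rmem s (ireg s y))
  | RStore x y => set_rmem s (ireg s x) (rreg s y)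
  end.

Definition run_test (R : realType) (b : test) (s : state R) : bool :=
  match b with
  | ILe x y => (ireg s x <= ireg s y)%N
  | ILt x y => (ireg s x < ireg s y)%N
  | RLe x y => rreg s x <= rreg s y
  | RLt x y => rreg s x < rreg s y
  end.

(* exec c s t s' : started in s, the command c halts in s' after t steps, a step
   being one instruction (Skip included) or one evaluation of a test. *)
Inductive exec (R : realType) : cmd -> state R -> nat -> state R -> Prop :=
  | exec_skip s : exec Skip s 1 s
  | exec_do c s : exec (Do c) s 1 (run_instr c s)
  | exec_seq c1 c2 s1 s2 s3 t1 t2 :
      exec c1 s1 t1 s2 -> exec c2 s2 t2 s3 ->
      exec (Seq c1 c2) s1 (t1 + t2)%N s3
  | exec_if_true b c1 c2 s s' t :
      run_test b s -> exec c1 s t s' -> exec (If b c1 c2) s t.+1 s'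
  | exec_if_false b c1 c2 s s' t :
      ~~ run_test b s -> exec c2 s t s' -> exec (If b c1 c2) s t.+1 s'
  | exec_while_true b c s1 s2 s3 t1 t2 :
      run_test b s1 -> exec c s1 t1 s2 -> exec (While b c) s2 t2 s3 ->
      exec (While b c) s1 (t1 + t2).+1 s3
  | exec_while_false b c s :
      ~~ run_test b s -> exec (While b c) s 1 s.

Lemma exec_det (R : realType) (c : cmd) (s s1 s2 : state R) (t1 t2 : nat) :
  exec c s t1 s1 -> exec c s t2 s2 -> t1 = t2 /\ s1 = s2.
Proof.
move=> h; elim: h t2 s2 => {c s t1 s1}.
- by move=> s t s' h; inversion h.
- by move=> c s t s' h; inversion h.
- move=> c1 c2 s1 s2 s3 t1 t2 _ IH1 _ IH2 t s' h.
  inversion h as [| |? ? ? ? ? ? ? e1 e2| | | |]; subst.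
  have [? ?] := IH1 _ _ e1; subst.
  by have [-> ->] := IH2 _ _ e2.
- move=> b c1 c2 s s' t hb _ IH t' s'' h.
  inversion h as [| | |? ? ? ? ? ? hb' e|? ? ? ? ? ? hb' e| |]; subst.
    by have [-> ->] := IH _ _ e.
  by rewrite hb in hb'.
- move=> b c1 c2 s s' t hb _ IH t' s'' h.
  inversion h as [| | |? ? ? ? ? ? hb' e|? ? ? ? ? ? hb' e| |]; subst.
    by rewrite hb' in hb.
  by have [-> ->] := IH _ _ e.
- move=> b c s1 s2 s3 t1 t2 hb _ IH1 _ IH2 t s' h.
  inversion h as [| | | | |? ? ? ? ? ? ? hb' e1 e2|? ? ? hb']; subst.
    have [? ?] := IH1 _ _ e1; subst.
    by have [-> ->] := IH2 _ _ e2.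
  by rewrite hb in hb'.
- move=> b c s hb t s' h.
  inversion h as [| | | | |? ? ? ? ? ? ? hb' e1 e2|? ? ? hb']; subst=> //.
  by rewrite hb' in hb.
Qed.

(* The n profits, then the d capacities, then the sizes, dimension by
   dimension. *)
Definition real_input (R : realType) (d n : nat) (I : mdkp R d n) : seq R :=
  [seq profit I j | j <- enum 'I_n] ++
  [seq capacity I i | i <- enum 'I_d] ++
  [seq isize I i j | i <- enum 'I_d, j <- enum 'I_n].

(* n and d are given in the integer registers 0 and 1, the numerical data at the
   beginning of the real memory; everything else is 0. *)
Definition init_state (R : realType) (d n : nat) (I : mdkp R d n) : state R :=
  State (nth 0%N [:: n; d]) (fun=> 0%N) (fun=> 0) (nth 0 (real_input I)).

Lemma real_input_profit (R : realType) (d n : nat) (I : mdkp R d n)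
    (j : 'I_n) : nth 0 (real_input I) j = profit I j.
Proof.
rewrite /real_input nth_cat size_map size_enum_ord ltn_ord.
by rewrite (nth_map j) ?size_enum_ord // nth_ord_enum.
Qed.

Lemma real_input_capacity (R : realType) (d n : nat) (I : mdkp R d n)
    (i : 'I_d) : nth 0 (real_input I) (n + i) = capacity I i.
Proof.
rewrite /real_input nth_cat size_map size_enum_ord ltnNge leq_addr /= addKn.
rewrite nth_cat size_map size_enum_ord ltn_ord.
by rewrite (nth_map i) ?size_enum_ord // nth_ord_enum.
Qed.

Lemma real_input_isize (R : realType) (d n : nat) (I : mdkp R d n)
    (i : 'I_d) (j : 'I_n) :
  nth 0 (real_input I) (n + (d + (i * n + j))) = isize I i j.
Proof.
rewrite /real_input nth_cat size_map size_enum_ord ltnNge leq_addr /= addKn.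
rewrite nth_cat size_map size_enum_ord ltnNge leq_addr /= addKn.
have gen : forall (s : seq 'I_d) k, (k < size s)%N ->
    nth 0 [seq isize I i j | i <- s, j <- enum 'I_n] (k * n + j) =
    isize I (nth i s k) j.
  elim=> [|x s IH] [|k] //= hk.
    rewrite nth_cat size_map size_enum_ord mul0n add0n ltn_ord.
    by rewrite (nth_map j) ?size_enum_ord // nth_ord_enum.
  rewrite nth_cat size_map size_enum_ord mulSn -addnA ltnNge leq_addr /= addKn.
  exact: IH.
by rewrite gen ?size_enum_ord // nth_ord_enum.
Qed.

(* The answer is the characteristic vector of the chosen set of items, in the
   first n cells of the integer memory. *)
Definition output (R : realType) (n : nat) (s : state R) : {set 'I_n} :=
  [set j : 'I_n | imem s j == 1%N].

(* Main.v *)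
Require Import Defs.
From HB Require Import structures.
From mathcomp Require Import all_boot all_order all_algebra.
From mathcomp Require Import reals zify.

(** A set of items is feasible iff all its pairs are (this is what an equivalent
    graph gives).  For a tuple [b] of one item per dimension, let [S_b] be the
    set of items [j] such that, in every dimension [i], [j] is not larger than
    [b_i] and either [j = b_i] or [j] fits together with [b_i].  Two items of
    [S_b] fit together in dimension [i] because the larger one can be replaced
    by [b_i]; hence [S_b] is feasible.  Conversely a nonempty feasible set [B]
    lies in [S_b] when [b_i] is an item of [B] of largest size in dimension
    [i].  So a best [S_b] is optimal, and scanning the [n ^ d] tuples, at cost
    [O(n d)] each, takes [O(n ^ (2 d + 1))] steps since [d <= n ^ d]. *)

Set Implicit Arguments.
Unset Strict Implicit.
Unset Printing Implicit Defensive.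

(** * Total correctness with time bounds for the while-language *)

Section CostedExecution.

Variable R : realType.
Implicit Types (s : state R) (c : cmd) (Q : state R -> Prop).

Definition instr_iregs (i : instr) : seq nat :=
  match i with
  | ISet x _ | IMove x _ | IAdd x _ _ | ISub x _ _ | ILoad x _ => [:: x]
  | _ => [::]
  end.

Definition instr_rregs (i : instr) : seq nat :=
  match i with
  | RZero x | RMove x _ | RAdd x _ _ | RSub x _ _ | RLoad x _ => [:: x]
  | _ => [::]
  end.

Definition instr_imem (i : instr) : bool :=
  if i is IStore _ _ then true else false.

Definition instr_rmem (i : instr) : bool :=
  if i is RStore _ _ then true else false.

Fixpoint instrs_of (c : cmd) : seq instr :=
  match c with
  | Skip => [::]
  | Do i => [:: i]
  | Seq c1 c2 | If _ c1 c2 => instrs_of c1 ++ instrs_of c2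
  | While _ c => instrs_of c
  end.

Definition written_iregs c := flatten (map instr_iregs (instrs_of c)).
Definition written_rregs c := flatten (map instr_rregs (instrs_of c)).

(** Read off the syntax of [c] alone, so that the invariants below mostly mention what [c] may
    change. *)
Record frame c s s' : Prop := Frame {
  frame_ireg : forall x, x \notin written_iregs c -> ireg s' x = ireg s x;
  frame_rreg : forall x, x \notin written_rregs c -> rreg s' x = rreg s x;
  frame_imem : ~~ has instr_imem (instrs_of c) -> imem s' = imem s;
  frame_rmem : ~~ has instr_rmem (instrs_of c) -> rmem s' = rmem s }.

Lemma frame_trans c s1 s2 s3 : frame c s1 s2 -> frame c s2 s3 -> frame c s1 s3.
Proof.
case=> a1 a2 a3 a4 [b1 b2 b3 b4]; split=> [x h|x h|h|h].
- by rewrite b1 ?a1.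
- by rewrite b2 ?a2.
- by rewrite b3 ?a3.
- by rewrite b4 ?a4.
Qed.

Lemma frame_sub c c' s s' :
  (exists l l', instrs_of c' = l ++ instrs_of c ++ l') ->
  frame c s s' -> frame c' s s'.
Proof.
move=> [l [l' e]] [h1 h2 h3 h4]; split=> [x h|x h|h|h].
- apply: h1; move: h; rewrite /written_iregs e !map_cat !flatten_cat !mem_cat.
  by rewrite !negb_or => /and3P[].
- apply: h2; move: h; rewrite /written_rregs e !map_cat !flatten_cat !mem_cat.
  by rewrite !negb_or => /and3P[].
- by apply: h3; move: h; rewrite e !has_cat !negb_or => /and3P[].
- by apply: h4; move: h; rewrite e !has_cat !negb_or => /and3P[].
Qed.

Lemma frame_do i s : frame (Do i) s (run_instr i s).
Proof.
by case: i => *; split=> //= z;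
  rewrite /written_iregs /written_rregs /= ?inE => h; rewrite /upd ?(negPf h).
Qed.

Lemma exec_frame c s t s' : exec c s t s' -> frame c s s'.
Proof.
elim=> {c s t s'} //.
- exact: frame_do.
- move=> c1 c2 s1 s2 s3 t1 t2 _ h1 _ h2.
  apply: (frame_trans (s2 := s2)); [apply: frame_sub h1|apply: frame_sub h2].
    by exists [::], (instrs_of c2).
  by exists (instrs_of c1), [::]; rewrite cats0.
- move=> b c1 c2 s s' t _ _; apply: frame_sub.
  by exists [::], (instrs_of c2).
- move=> b c1 c2 s s' t _ _; apply: frame_sub.
  by exists (instrs_of c1), [::]; rewrite cats0.
- move=> b c s1 s2 s3 t1 t2 _ _ h1 _ h2.
  apply: frame_trans h2; apply: frame_sub h1.
  by exists [::], [::]; rewrite cats0.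
Qed.

(** The time is bounded rather than exact, so that branches of different lengths can share one
    [T]. *)
Definition wp c T Q s : Prop :=
  exists t s', [/\ exec c s t s', t <= T & Q s'].

Lemma wp_conseq c T T' Q Q' s :
  wp c T Q s -> T <= T' -> (forall s', frame c s s' -> Q s' -> Q' s') ->
  wp c T' Q' s.
Proof.
move=> [t [s' [e le_t q]]] leT hQ; exists t, s'; split=> //.
  exact: leq_trans leT.
by apply: hQ => //; apply: exec_frame e.
Qed.

Lemma wp_skip T Q s : 0 < T -> Q s -> wp Skip T Q s.
Proof. by move=> T0 q; exists 1, s; split=> //; constructor. Qed.

Lemma wp_do T i Q s : 0 < T -> Q (run_instr i s) -> wp (Do i) T Q s.
Proof. by move=> T0 q; exists 1, (run_instr i s); split=> //; constructor. Qed.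

Lemma wp_seq c1 c2 T1 T2 Q s :
  wp c1 T1 (wp c2 T2 Q) s -> wp (Seq c1 c2) (T1 + T2) Q s.
Proof.
move=> [t1 [s1 [e1 le1 [t2 [s2 [e2 le2 q]]]]]].
by exists (t1 + t2), s2; split; [apply: exec_seq e1 e2|apply: leq_add|].
Qed.

Lemma wp_if b c1 c2 T Q s :
  (run_test b s -> wp c1 T Q s) -> (~~ run_test b s -> wp c2 T Q s) ->
  wp (If b c1 c2) T.+1 Q s.
Proof.
case: (boolP (run_test b s)) => hb h1 h2.
  have [t [s' [e le q]]] := h1 isT.
  by exists t.+1, s'; split=> //; apply: exec_if_true.
have [t [s' [e le q]]] := h2 isT.
by exists t.+1, s'; split=> //; apply: exec_if_false.
Qed.

Definition block (l : seq instr) c := foldr (fun i => Seq (Do i)) c l.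

Lemma wp_block l c T Q s :
  wp c T Q (foldl (fun s i => run_instr i s) s l) ->
  wp (block l c) (size l + T) Q s.
Proof.
elim: l s => //= i l IH s h; rewrite addSn -add1n; apply: wp_seq.
by apply: wp_do => //; apply: IH.
Qed.

(** Rule for loops whose number [N] of rounds is known in advance: each round costs [T] plus one
    test, and the final failing test costs 1. The frame relates the entry state [s] to every
    intermediate state, which keeps unchanged data out of [Inv]. *)
Lemma wp_while b c T N (Inv : nat -> state R -> Prop) s :
  Inv 0 s ->
  (forall k s', k <= N -> frame c s s' -> Inv k s' ->
    run_test b s' = (k < N)) ->
  (forall k s', k < N -> frame c s s' -> Inv k s' -> wp c T (Inv k.+1) s') ->
  wp (While b c) (N * T.+1 + 1) (Inv N) s.
Proof.
move=> inv0 hb hc.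
suff gen M k s' : k + M = N -> frame c s s' -> Inv k s' ->
    wp (While b c) (M * T.+1 + 1) (Inv N) s'.
  by apply: (gen N 0).
elim: M k s' => [|M IH] k s' kM fr inv.
  exists 1, s'; rewrite mul0n; split=> //; last by rewrite -kM addn0.
  by apply: exec_while_false; rewrite (hb k) // -kM ?addn0 ?ltnn.
have ltk : k < N by rewrite -kM; lia.
have [t1 [s1 [e1 le1 inv1]]] := hc k s' ltk fr inv.
have fr1 := frame_trans fr (exec_frame e1).
have [t2 [s2 [e2 le2 inv2]]] : wp (While b c) (M * T.+1 + 1) (Inv N) s1.
  by apply: (IH k.+1); rewrite // -kM; lia.
exists (t1 + t2).+1, s2; split=> //; last by lia.
by apply: exec_while_true e1 e2; rewrite (hb k) // ltnW.
Qed.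

End CostedExecution.

#[local] Arguments block : simpl never.

(** * Feasible sets and the candidate sets of tuples *)

Section Candidates.

Import Order.TTheory GRing.Theory Num.Theory.
Local Open Scope ring_scope.
Variables (R : realType) (d n : nat) (I : mdkp R d n).

Definition candidate (b : 'I_d -> 'I_n) : {set 'I_n} :=
  [set j | [forall i, (isize I i j <= isize I i (b i)) &&
    ((b i == j) || (isize I i j + isize I i (b i) <= capacity I i))]].

Lemma feasible_pair (j k : 'I_n) : j != k ->
  feasible I [set j; k] <->
  forall i, isize I i j + isize I i k <= capacity I i.
Proof.
move=> jk; rewrite /feasible; split=> h i; move: (h i);
  by rewrite big_setU1 ?inE //= big_set1.
Qed.

(** Independence is a condition on pairs of vertices, and a pair of equal vertices is harmless by
    irreflexivity. This is where the graph itself enters. *)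
Lemma feasible_pairwise (A : {set 'I_n}) : has_equivalent_graph I ->
  {in A &, forall j k, j != k -> feasible I [set j; k]} -> feasible I A.
Proof.
move=> [G [f [_ fP]]] h; apply/fP => _ _ /imsetP[j jA ->] /imsetP[k kA ->].
have [<-|jk] := eqVneq j k; first by rewrite edge_irr.
apply: (proj1 (fP _) (h j k jA kA jk)); apply: imset_f;
  by rewrite !inE eqxx ?orbT.
Qed.

Lemma candidate_feasible (b : 'I_d -> 'I_n) :
  has_equivalent_graph I -> feasible I (candidate b).
Proof.
move=> hG; apply: feasible_pairwise => // j k.
rewrite !inE => /forallP hj /forallP hk jk; apply/feasible_pair => // i.
(* If [j] is [b i], then [k] is not, so [k] fits together with [b i], which is [j]. Otherwise [j]
   fits together with [b i], and [k] is no larger than [b i]. *)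
have /andP[lej /orP[/eqP bj|cj]] := hj i.
  have /andP[_ /orP[/eqP bk|]] := hk i; last by rewrite bj addrC.
  by rewrite -bj bk eqxx in jk.
have /andP[lek _] := hk i.
by apply: le_trans cj; rewrite lerD2l.
Qed.

Lemma sub_candidate (B : {set 'I_n}) : feasible I B -> B != set0 ->
  exists b, B \subset candidate b.
Proof.
move=> fB /set0Pn[j0 j0B].
exists (fun i => [arg max_(j > j0 in B) isize I i j]%O).
apply/subsetP => j jB; rewrite inE; apply/forallP => i.
case: Order.TotalTheory.arg_maxP => // k kB kmax.
have -> /= : isize I i j <= isize I i k := kmax j jB.
(* Distinct [j] and [k] both lie in [B], so their sizes are two terms of a non-negative sum bounded
   by the capacity. *)
have [//|kj] := eqVneq k j; apply: le_trans (fB i).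
rewrite (bigD1 j) //= (bigD1 k) ?kB //= lerD2l lerDl.
by apply: sumr_ge0 => l _; apply: isize_ge0.
Qed.

Lemma total_profit_sub (A B : {set 'I_n}) : A \subset B ->
  total_profit I A <= total_profit I B.
Proof.
move=> /subsetP sAB; rewrite /total_profit [leRHS](big_setID A) /=.
have /setIidPr -> : A \subset B by apply/subsetP.
by rewrite lerDl sumr_ge0 // => l _; apply: profit_ge0.
Qed.

(** Only the empty set escapes [sub_candidate], and its profit 0 is at most that of [A]. *)
Lemma optimal_of_candidates (A : {set 'I_n}) :
  feasible I A ->
  (forall b, total_profit I (candidate b) <= total_profit I A) ->
  optimal I A.
Proof.
move=> fA hA; split=> // B fB.
have [->|B0] := eqVneq B set0.
  by rewrite {1}/total_profit big_set0 sumr_ge0 // => l _; apply: profit_ge0.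
have [b sB] := sub_candidate fB B0.
exact: le_trans (total_profit_sub sB) (hA b).
Qed.

Lemma feasible0 : feasible I set0.
Proof. by move=> i; rewrite big_set0 capacity_ge0. Qed.

End Candidates.

(** * Tuples as base [n] expansions of their ranks *)

Definition digit (n k i : nat) := (k %/ n ^ i) %% n.

Lemma digit_lt n k i : 0 < n -> digit n k i < n.
Proof. by move=> n0; rewrite ltn_mod. Qed.

Lemma digit0 n i : digit n 0 i = 0.
Proof. by rewrite /digit div0n mod0n. Qed.

Lemma digit_surj n d (b : nat -> nat) : 0 < n -> (forall i, i < d -> b i < n) ->
  exists2 k, k < n ^ d & forall i, i < d -> digit n k i = b i.
Proof.
move=> n0; elim: d => [|d IH] hb; first by exists 0.
have [|k kd hk] := IH; first by move=> i id; apply: hb; apply: ltnW.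
have nd0 i : 0 < n ^ i by rewrite expn_gt0 n0.
(* [b d] becomes the new leading digit. After division by [n ^ i] with [i < d] it contributes a
   multiple of [n], so the lower digits are those of [k]. *)
exists (b d * n ^ d + k).
  rewrite expnS; apply: (@leq_trans ((b d).+1 * n ^ d)).
    by rewrite mulSn addnC ltn_add2r.
  by rewrite leq_mul2r hb ?orbT.
move=> i; rewrite ltnS leq_eqVlt => /orP[/eqP ->|id].
  by rewrite /digit divnMDl // (divn_small kd) addn0 modn_small ?hb.
rewrite /digit -(subnK (ltnW id)) expnD mulnA divnMDl //.
have -> : d - i = (d - i).-1.+1 by lia.
by rewrite expnSr mulnA modnMDl; apply: hk.
Qed.

(** One step of addition with carry: when 1 is added to [k], position [i] receives a carry exactly
    when [n ^ i] divides [k.+1], and passes one on exactly when [n ^ i.+1] does. *)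
Lemma digit_succ n k i : 0 < n ->
  let v := digit n k i + (n ^ i %| k.+1) in
  if n <= v then digit n k.+1 i = 0 /\ n ^ i.+1 %| k.+1
  else digit n k.+1 i = v /\ ~~ (n ^ i.+1 %| k.+1).
Proof.
move=> n0 v; have ni0 : 0 < n ^ i by rewrite expn_gt0 n0.
have lt := digit_lt k i n0.
have dE : digit n k.+1 i = v %% n.
  by rewrite /digit divnS // addnC -modnDml.
have cE : n ^ i.+1 %| k.+1 = (n ^ i %| k.+1) && (v %% n == 0).
  rewrite -dE /digit; have [/dvdnP[q ->]|nd] /= := boolP (n ^ i %| k.+1).
    by rewrite mulnK // expnS dvdn_pmul2r.
  by apply: contraNF nd => /(dvdn_trans _); apply; rewrite expnS dvdn_mull.
case: leqP => vn; rewrite dE cE.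
  have vE : v = n by move: vn lt; rewrite /v; case: (_ %| _); lia.
  by rewrite vE modnn; move: vE lt; rewrite /v; case: (_ %| _) => //; lia.
rewrite modn_small //; split=> //.
by rewrite /v; case: (_ %| _); rewrite //= addn1.
Qed.

(** * The search program *)

Section Program.

(* Integer memory: cells [0, n) hold the best set found so far, cells [n, n + d)
   the current tuple (as the base n digits of its rank, least significant
   first), cells [n + d, 2 n + d) the candidate of that tuple.  The register
   zero is never written. *)
Local Notation N := 0 (only parsing).
Local Notation D := 1 (only parsing).
Local Notation one := 2 (only parsing).
Local Notation base := 3 (only parsing).
Local Notation carry := 4 (only parsing).
Local Notation J := 5 (only parsing).
Local Notation I := 6 (only parsing).
Local Notation row := 7 (only parsing).
Local Notation ok := 8 (only parsing).
Local Notation B := 9 (only parsing).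
Local Notation addr := 10 (only parsing).
Local Notation tmp := 11 (only parsing).
Local Notation zero := 12 (only parsing).
Local Notation best := 0 (only parsing).
Local Notation cur := 1 (only parsing).
Local Notation cap := 2 (only parsing).
Local Notation sJ := 3 (only parsing).
Local Notation sB := 4 (only parsing).
Local Notation sum := 5 (only parsing).

(** [row] advances by [n] per dimension, which replaces a multiplication. [ok] is only ever cleared
    here, and equality of [B] and [J] is decided by two strict comparisons. *)
Definition check_dim : cmd :=
  block [:: IAdd addr N I; ILoad B addr; RLoad cap addr;
            IAdd addr row J; RLoad sJ addr;
            IAdd addr row B; RLoad sB addr;
            RAdd sum sJ sB; IAdd row row N; IAdd I I one]
    (If (RLe sJ sB)
       (If (RLe sum cap) Skip
          (If (ILt B J) (Do (ISet ok 0))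
             (If (ILt J B) (Do (ISet ok 0)) Skip)))
       (Do (ISet ok 0))).

(** Profits open the real memory, so [J] is also the address of the profit of its item; [sJ] is
    reused to hold it. *)
Definition check_item : cmd :=
  block [:: IMove row base; ISet ok 1; ISet I 0]
    (Seq (While (ILt I D) check_dim)
       (block [:: IAdd addr base J; IStore addr ok]
          (If (ILt zero ok)
             (block [:: RLoad sJ J; RAdd cur cur sJ; IAdd J J one] Skip)
             (Do (IAdd J J one))))).

Definition copy_item : cmd :=
  block [:: IAdd addr base J; ILoad tmp addr; IStore J tmp; IAdd J J one] Skip.

Definition try_candidate : cmd :=
  block [:: RZero cur; ISet J 0]
    (Seq (While (ILt J N) check_item)
       (If (RLt best cur)
          (block [:: RMove best cur; ISet J 0] (While (ILt J N) copy_item))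
          Skip)).

Definition next_digit : cmd :=
  block [:: IAdd addr N I; ILoad tmp addr; IAdd tmp tmp carry]
    (Seq (If (ILe N tmp)
            (block [:: ISet carry 1; ISet tmp 0] Skip)
            (Do (ISet carry 0)))
       (block [:: IStore addr tmp; IAdd I I one] Skip)).

(** A carry out of the last digit means that the counter has wrapped around: every tuple has been
    visited. *)
Definition next_tuple : cmd :=
  block [:: ISet carry 1; ISet I 0] (While (ILt I D) next_digit).

(** The initial zeros are meaningful: the best set starts empty with profit 0, the first tuple has
    all digits 0, and [carry] is 0, so the loop is entered. *)
Definition solver : cmd :=
  block [:: ISet one 1; IAdd base N D]
    (If (ILt zero N)
       (While (ILt carry one) (Seq try_candidate next_tuple))
       Skip).

(** * Cost and effect of each piece of the program *)

Variables (R : realType) (d n : nat) (r : nat -> R).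
Implicit Types (s : state R) (b : nat -> nat).

Record context s : Prop := Context {
  ctxN : ireg s N = n;
  ctxD : ireg s D = d;
  ctx1 : ireg s one = 1;
  ctxB : ireg s base = n + d;
  ctx0 : ireg s zero = 0;
  ctxr : rmem s = r }.

(** The first two hypotheses are closed booleans for a concrete [c], so computation discharges
    them. *)
Lemma context_frame c s s' :
  all (fun x => x \notin written_iregs c) [:: N; D; one; base; zero] ->
  ~~ has instr_rmem (instrs_of c) ->
  frame c s s' -> context s -> context s'.
Proof.
move=> /and5P[h1 h2 h3 h4 /andP[h5 _]] hr fr [c1 c2 c3 c4 c5 c6].
by split; rewrite ?(frame_ireg fr) ?(frame_rmem fr).
Qed.

(** The membership condition of [candidate] in one dimension, phrased over natural numbers and the
    raw memory layout. *)
Definition fits b j i : bool :=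
  let sj := r (n + d + i * n + j) in
  let sb := r (n + d + i * n + b i) in
  (sj <= sb)%R && ((b i == j) || (sj + sb <= r (n + i))%R).

Lemma wp_check_dim b j i (o : bool) s : context s ->
  ireg s J = j -> ireg s I = i -> ireg s row = n + d + i * n ->
  imem s (n + i) = b i -> ireg s ok = o ->
  wp check_dim 15 (fun s' => [/\ ireg s' I = i.+1,
    ireg s' row = n + d + i.+1 * n & ireg s' ok = o && fits b j i]) s.
Proof.
move=> [cN cD c1 cB c0 cr] hj hi hrow hb ho.
(* [5] pays for the longest branch: four tests and one final command. *)
apply: (@wp_block _ _ _ 5); rewrite /= /upd /= cN hi hj hrow cr hb c1.
have ii : i + 1 = i.+1 by rewrite addn1.
have rr : n + d + i * n + n = n + d + i.+1 * n by rewrite mulSn; lia.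
apply: wp_if; rewrite /= /upd /= => h1; last first.
  by apply: wp_do; rewrite //= /upd /= /fits (negPf h1) andbF.
apply: wp_if; rewrite /= /upd /= => h2.
  by apply: wp_skip; rewrite //= /upd /= /fits h1 h2 orbT !andbT.
apply: wp_if; rewrite /= /upd /= hj => h3.
  apply: wp_do; rewrite //= /upd /= /fits (negPf h2) orbF.
  by rewrite (ltn_eqF h3) !andbF.
apply: wp_if; rewrite /= /upd /= hj => h4.
  apply: wp_do; rewrite //= /upd /= /fits (negPf h2) orbF.
  by rewrite (gtn_eqF h4) !andbF.
have bj : b i == j by rewrite eqn_leq leqNgt h4 leqNgt h3.
by apply: wp_skip; rewrite //= /upd /= /fits h1 bj !andbT.
Qed.

Definition accepted b j : bool := all (fits b j) (iota 0 d).

Lemma wp_check_item b j s : context s -> ireg s J = j ->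
  (forall i, i < d -> imem s (n + i) = b i) ->
  wp check_item (16 * d + 11) (fun s' => [/\ ireg s' J = j.+1,
    rreg s' cur = (rreg s cur + (if accepted b j then r j else 0))%R
    & imem s' = upd (imem s) (n + d + j) (accepted b j)]) s.
Proof.
move=> ctx hj hb; case: (ctx) => cN cD c1 cB c0 cr.
(* Three initialisations, [d] rounds of 15 steps and a test, the failing test, two instructions, and
   at most 5 steps for the last conditional. *)
have -> : 16 * d + 11 = 3 + ((d * 16 + 1) + (2 + 5)) by lia.
apply: wp_block; set s1 := foldl _ _ _; apply: wp_seq.
have ctx1 : context s1 by split; rewrite /s1 //= /upd /= ?cB ?cr.
have j1 : ireg s1 J = j by [].
apply: (wp_conseq (T := d * 16 + 1)
  (Q := fun s' => [/\ ireg s' I = d, ireg s' row = n + d + d * n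
                    & ireg s' ok = accepted b j])) => //; last first.
  move=> s2 fr [_ _ ok2].
  have [e1 e2 e3 e4 e5 e6] :=
    context_frame (c := While (ILt I D) check_dim) isT isT fr ctx1.
  have j2 : ireg s2 J = j by rewrite (frame_ireg fr).
  have m2 : imem s2 = imem s by rewrite (frame_imem fr).
  have r2 : rreg s2 cur = rreg s cur by rewrite (frame_rreg fr).
  apply: wp_block; rewrite /= /upd /=.
  apply: wp_if; rewrite /= /upd /= e5 ok2 lt0b => hok.
    apply: (@wp_block _ _ _ 1); apply: wp_skip; rewrite //= /upd /= hok.
    by rewrite e3 e4 e6 j2 m2 r2 addn1.
  apply: wp_do; rewrite //= /upd /= (negPf hok) GRing.addr0.
  by rewrite e3 e4 j2 m2 r2 addn1.
pose Inv i s' := [/\ ireg s' I = i, ireg s' row = n + d + i * n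
                   & ireg s' ok = all (fits b j) (iota 0 i)].
apply: (wp_while (Inv := Inv)).
- by split; rewrite /s1 //= /upd /= cB mul0n addn0.
- move=> k s' _ fr [hI _ _] /=; rewrite hI.
  by case: (context_frame (c := check_dim) isT isT fr ctx1) => _ ->.
- move=> k s' kd fr [hI hrow hok].
  have ctx' := context_frame (c := check_dim) isT isT fr ctx1.
  apply: (wp_conseq
    (wp_check_dim (b := b) (j := j) ctx' _ hI hrow _ hok)) => //.
  + by rewrite (frame_ireg fr).
  + by rewrite (frame_imem fr) // hb.
  + move=> s2 _ [e1 e2 e3]; split=> //.
    by rewrite e3 -addn1 iotaD all_cat /= andbT.
Qed.

Definition value b : R := (\sum_(0 <= k < n | accepted b k) r k)%R.

Lemma wp_check_items b s : context s -> ireg s J = 0 -> rreg s cur = 0%R ->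
  (forall i, i < d -> imem s (n + i) = b i) ->
  wp (While (ILt J N) check_item) (n * (16 * d + 12) + 1) (fun s' =>
    [/\ rreg s' cur = value b, forall j, j < n ->
        imem s' (n + d + j) = accepted b j
      & forall m, m < n + d -> imem s' m = imem s m]) s.
Proof.
move=> ctx J0 cur0 hb.
pose Inv j s' := [/\ ireg s' J = j,
  rreg s' cur = (\sum_(0 <= k < j | accepted b k) r k)%R,
  forall k, k < j -> imem s' (n + d + k) = accepted b k
  & forall m, m < n + d -> imem s' m = imem s m].
have -> : 16 * d + 12 = (16 * d + 11).+1 by lia.
apply: (wp_conseq (wp_while (N := n) (Inv := Inv) _ _ _)) => //.
- by split=> //; rewrite big_geq.
- move=> k s' _ fr [hJ _ _ _] /=; rewrite hJ.
  by case: (context_frame (c := check_item) isT isT fr ctx) => ->.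
- move=> k s' kn fr [hJ hcur hacc hm].
  have ctx' := context_frame (c := check_item) isT isT fr ctx.
  apply: (wp_conseq (wp_check_item (b := b) ctx' hJ _)) => //.
    by move=> i id; rewrite hm ?hb // ltn_add2l.
  move=> s2 _ [e1 e2 e3]; split=> //.
  + by rewrite e2 hcur big_mkcond /= [RHS]big_mkcond big_nat_recr.
  + move=> l; rewrite e3 /upd eqn_add2l; case: eqP => [-> //|kl lk].
    by rewrite hacc //; lia.
  + move=> m lm; rewrite e3 /upd; case: eqP => [|_]; last exact: hm.
    by lia.
- by move=> s' _ [].
Qed.

Lemma wp_copy_items s : context s -> ireg s J = 0 ->
  wp (While (ILt J N) copy_item) (n * 6 + 1) (fun s' =>
    (forall j, j < n -> imem s' j = imem s (n + d + j)) /\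
    (forall m, n <= m -> imem s' m = imem s m)) s.
Proof.
move=> ctx J0.
(* Sources lie at [n + d] and above, destinations below [n], so copying never damages a source. *)
pose Inv j s' := [/\ ireg s' J = j,
  forall k, k < j -> imem s' k = imem s (n + d + k)
  & forall m, n <= m -> imem s' m = imem s m].
apply: (wp_conseq (wp_while (N := n) (T := 5) (Inv := Inv) _ _ _)) => //.
- move=> k s' _ fr [hJ _ _] /=; rewrite hJ.
  by case: (context_frame (c := copy_item) isT isT fr ctx) => ->.
- move=> k s' kn fr [hJ hk hm].
  have [e1 e2 e3 e4 e5 e6] := context_frame (c := copy_item) isT isT fr ctx.
  apply: (@wp_block _ _ _ 1); apply: wp_skip; rewrite //= /upd /= e3 e4 hJ.
  split; rewrite ?addn1 //.
  + move=> l; rewrite /= /upd; case: eqP => [-> _|lk l1].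
      by rewrite hm //; lia.
    by rewrite hk //; lia.
  + by move=> m nm; rewrite /= /upd; case: eqP => [|_]; [lia|rewrite hm].
- by move=> s' _ [].
Qed.

Lemma wp_try_candidate b s : context s ->
  (forall i, i < d -> imem s (n + i) = b i) ->
  wp try_candidate (n * (16 * d + 18) + 7) (fun s' =>
    (forall i, i < d -> imem s' (n + i) = b i) /\
    (if (rreg s best < value b)%R
     then rreg s' best = value b /\
          forall j, j < n -> imem s' j = accepted b j
     else rreg s' best = rreg s best /\
          forall j, j < n -> imem s' j = imem s j)) s.
Proof.
move=> ctx hb; case: (ctx) => cN cD c1 cB c0 cr.
(* Two initialisations, the scan of the items, then the comparison of profits, two instructions and
   the copy. *)
have -> : n * (16 * d + 18) + 7 =
  2 + ((n * (16 * d + 12) + 1) + (2 + (n * 6 + 1)).+1) by lia.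
apply: wp_block; set s1 := foldl _ _ _; apply: wp_seq.
have ctx1 : context s1 by split; rewrite /s1 //= /upd /= ?cB ?cr.
apply: (wp_conseq (wp_check_items (b := b) ctx1 _ _ _)) => //.
move=> s2 fr [cur2 acc2 m2].
have ctx2 := context_frame (c := While (ILt J N) check_item) isT isT fr ctx1.
have best2 : rreg s2 best = rreg s best by rewrite (frame_rreg fr).
apply: wp_if; rewrite /= cur2 best2 => hv; last first.
  apply: wp_skip; first by lia.
  rewrite (negPf hv); split=> [i id|]; first by rewrite m2 ?hb // ltn_add2l.
  by split=> // j jn; rewrite m2 // ltn_addr.
rewrite hv; apply: wp_block; set s3 := foldl _ _ _.
have ctx3 : context s3 by case: ctx2.
apply: (wp_conseq (wp_copy_items ctx3 _)) => //.
move=> s4 fr4 [h1 h2]; split.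
  by move=> i id; rewrite h2 ?leq_addr // /s3 /= m2 ?hb // ltn_add2l.
split; first by rewrite (frame_rreg fr4) //= /upd /= cur2.
by move=> j jn; rewrite h1 // /s3 /= acc2.
Qed.

Lemma wp_next_tuple k s : 0 < n -> context s ->
  (forall i, i < d -> imem s (n + i) = digit n k i) ->
  wp next_tuple (d * 11 + 3) (fun s' => [/\ ireg s' carry = (n ^ d %| k.+1),
    forall i, i < d -> imem s' (n + i) = digit n k.+1 i
    & forall m, m < n -> imem s' m = imem s m]) s.
Proof.
move=> n0 ctx hk; case: (ctx) => cN cD c1 cB c0 cr.
have -> : d * 11 + 3 = 2 + (d * 11 + 1) by lia.
apply: wp_block; set s1 := foldl _ _ _.
have ctx1 : context s1 by split; rewrite /s1 //= /upd /= ?cB ?cr.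
(* Below [i] the digits already belong to [k.+1], from [i] on still to [k]. The initial carry 1 is
   right because [n ^ 0] is 1. *)
pose Inv i s' := [/\ ireg s' I = i, ireg s' carry = (n ^ i %| k.+1),
  forall l, l < i -> imem s' (n + l) = digit n k.+1 l,
  forall l, i <= l < d -> imem s' (n + l) = digit n k l
  & forall m, m < n -> imem s' m = imem s m].
apply: (wp_conseq (wp_while (N := d) (T := 10) (Inv := Inv) _ _ _)) => //.
- by split; rewrite // dvd1n.
- move=> i s' _ fr [hI _ _ _ _] /=; rewrite hI.
  by case: (context_frame (c := next_digit) isT isT fr ctx1) => _ ->.
- move=> i s' id fr [hI hc hlo hhi hm].
  have [e1 e2 e3 e4 e5 e6] := context_frame (c := next_digit) isT isT fr ctx1.
  apply: (@wp_block _ _ _ (4 + 3)); rewrite /= /upd /= e1 hI hc hhi ?leqnn //.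
  have := digit_succ k i n0; set v := (digit n k i + _) => /= hv.
  (* Both outcomes of the test share this tail; [q] is the new digit and [o] the outgoing carry. *)
  have next s2 q (o : bool) : digit n k.+1 i = q -> n ^ i.+1 %| k.+1 = o ->
      ireg s2 I = i -> ireg s2 carry = o -> ireg s2 tmp = q ->
      ireg s2 addr = n + i -> ireg s2 one = 1 -> imem s2 = imem s' ->
      wp (block [:: IStore addr tmp; IAdd I I one] Skip) 3 (Inv i.+1) s2.
    move=> dq dvo h1 h2 h3 h4 h5 h6.
    apply: (@wp_block _ _ _ 1); apply: wp_skip; rewrite //= /upd /=.
    split; rewrite /= ?h1 ?h2 ?h3 ?h4 ?h5 ?h6 ?addn1 ?dvo //.
    + move=> l; rewrite /= /upd ?h4 eqn_add2l; case: eqP => [-> //|li l1].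
      by rewrite hlo //; lia.
    + move=> l; rewrite /= /upd ?h4 eqn_add2l; case: eqP => [->|li l1].
        by lia.
      by rewrite hhi //; lia.
    + by move=> m mn; rewrite /= /upd; case: eqP => [|_]; [lia|rewrite hm].
  apply: wp_seq; apply: wp_if; rewrite /= /upd /= e1 => nv.
    rewrite nv in hv; case: hv => h1 h2.
    apply: (@wp_block _ _ _ 1); apply: wp_skip => //.
    by apply: (next _ 0 true).
  rewrite (negPf nv) in hv; case: hv => h1 /negPf h2.
  by apply: wp_do => //; apply: (next _ v false).
- by move=> s' _ [_ h1 h2 _ h3].
Qed.

End Program.

(** * Optimality and running time of the search *)

Section Solver.

Import Order.TTheory GRing.Theory Num.Theory.
Local Open Scope ring_scope.
Variables (R : realType) (d n : nat) (I : mdkp R d n).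
Let r := nth 0 (real_input I).

Lemma accepted_candidate (b : 'I_d -> 'I_n) (b' : nat -> nat) (j : 'I_n) :
  (forall i : 'I_d, b' i = b i) -> accepted d n r b' j = (j \in candidate I b).
Proof.
move=> bb; rewrite inE.
have fitsE (i : 'I_d) : fits d n r b' j i =
    (isize I i j <= isize I i (b i)) &&
    ((b i == j) || (isize I i j + isize I i (b i) <= capacity I i)).
  rewrite /fits bb -!addnA /r !real_input_isize real_input_capacity.
  by rewrite -val_eqE.
apply/allP/forallP => [h i|h i]; first by rewrite -fitsE h // mem_iota /=.
by rewrite mem_iota add0n => /andP[_ id]; rewrite (fitsE (Ordinal id)).
Qed.

Lemma value_candidate (b : 'I_d -> 'I_n) (b' : nat -> nat) :
  (forall i : 'I_d, b' i = b i) ->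
  value d n r b' = total_profit I (candidate I b).
Proof.
move=> bb; rewrite /value big_mkord; apply: eq_big => [j|j _].
  exact: accepted_candidate.
exact: real_input_profit.
Qed.

Definition tuple_of (n_gt0 : (0 < n)%N) (k : nat) : 'I_d -> 'I_n :=
  fun i => Ordinal (digit_lt k i n_gt0).

(** Integer register 4 is the carry, real register 0 the best profit. [A] need not be identified:
    being feasible and dominating all visited candidates is what optimality will ask for. *)
Definition search_inv (n_gt0 : (0 < n)%N) (k : nat) (s : state R) : Prop :=
  exists A : {set 'I_n},
  [/\ context d n r s, ireg s 4%N = (n ^ d <= k)%N,
      forall i, (i < d)%N -> imem s (n + i)%N = digit n k i
    & [/\ feasible I A, rreg s 0%N = total_profit I A,
          forall j : 'I_n, imem s j = (j \in A)
        & forall l, (l < k)%N ->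
          total_profit I (candidate I (tuple_of n_gt0 l)) <= total_profit I A]].

Lemma wp_search_step (n_gt0 : (0 < n)%N) k s : has_equivalent_graph I ->
  (k < n ^ d)%N -> search_inv n_gt0 k s ->
  wp (Seq try_candidate next_tuple) ((n * (16 * d + 18) + 7) + (d * 11 + 3))
    (search_inv n_gt0 k.+1) s.
Proof.
move=> hG kn [A [ctx _ hk [fA bestA outA maxA]]].
pose b := tuple_of n_gt0 k.
have valE : value d n r (digit n k) = total_profit I (candidate I b).
  exact: value_candidate.
apply: wp_seq; apply: (wp_conseq (wp_try_candidate ctx hk)) => //.
move=> s1 fr1 [hk1 best1].
have ctx1 := context_frame (c := try_candidate) isT isT fr1 ctx.
apply: (wp_conseq (wp_next_tuple n_gt0 ctx1 hk1)) => // s2 fr2 [c2 hk2 m2].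
have ctx2 := context_frame (c := next_tuple) isT isT fr2 ctx1.
(* Since [k.+1] is positive and at most [n ^ d], it is divisible by [n ^ d] only if equal to it. *)
have carryE : ireg s2 4%N = (n ^ d <= k.+1)%N.
  rewrite c2; congr (nat_of_bool _); apply/idP/idP => [/dvdn_leq ->//|le].
  by rewrite (_ : k.+1 = n ^ d)%N //; apply/eqP; rewrite eqn_leq kn.
have best2 : rreg s2 0%N = rreg s1 0%N by rewrite (frame_rreg fr2).
move: best1; rewrite valE bestA.
have [lt [b1 o1]|le [b1 o1]] := ltP.
  exists (candidate I b); split=> //; split; rewrite ?best2 //.
  - exact: candidate_feasible.
  - by move=> j; rewrite m2 // o1 // (accepted_candidate (b := b)).
  - move=> l; rewrite ltnS leq_eqVlt => /orP[/eqP -> //|lk].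
    exact: le_trans (maxA l lk) (ltW lt).
exists A; split=> //; split; rewrite ?best2 //.
- by move=> j; rewrite m2 // o1 // outA.
- by move=> l; rewrite ltnS leq_eqVlt => /orP[/eqP -> //|lk]; apply: maxA.
Qed.

Lemma solver_correct : has_equivalent_graph I ->
  wp solver (n ^ d * (n * (16 * d + 18) + 11 * d + 11) + 4)
    (fun s => optimal I (output n s)) (init_state I).
Proof.
move=> hG.
have -> : (n ^ d * (n * (16 * d + 18) + 11 * d + 11) + 4 =
  2 + (n ^ d * ((n * (16 * d + 18) + 7) + (d * 11 + 3)).+1 + 1).+1)%N by lia.
apply: wp_block; set s0 := foldl _ _ _.
apply: wp_if => /= n0; last first.
  have nE : n = 0%N by move: n0; rewrite /upd /=; lia.
  have noitem (A : {set 'I_n}) : A = set0.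
    by apply/setP => j; have := ltn_ord j; rewrite [X in (_ < X)%N]nE.
  apply: wp_skip; first by rewrite addn1.
  apply: optimal_of_candidates.
    by rewrite (noitem (output _ _)); apply: feasible0.
  by move=> b; rewrite (noitem (output _ _)) (noitem (candidate _ _)).
have {}n0 : (0 < n)%N by move: n0; rewrite /upd.
apply: (wp_conseq (wp_while (N := n ^ d) (Inv := search_inv n0) _ _ _)) => //.
- exists set0; split=> //.
  + by rewrite leqn0 expn_eq0 eqn0Ngt n0.
  + by move=> i _; rewrite digit0.
  + split=> //; [exact: feasible0|by rewrite /total_profit big_set0|].
    by move=> j; rewrite inE.
- move=> k s kn _ [A [[_ _ c1 _ _ _] c4 _ _]] /=.
  by rewrite c4 c1 ltnS leqn0 eqb0 ltnNge.
- by move=> k s kn _; apply: wp_search_step.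
move=> s _ [A [_ _ _ [fA _ outA maxA]]].
have -> : output n s = A by apply/setP => j; rewrite inE outA; case: (j \in A).
apply: optimal_of_candidates => // b.
(* [b] is extended by 0 outside the dimensions, to a function on [nat] whose values can serve as
   digits. *)
pose b' i := odflt 0%N (omap (fun i => b i : nat) (insub i)).
have [i id|l ln lb] := @digit_surj n d b' n0.
  by rewrite /b' insubT /=.
(* The two tuples agree pointwise; passing through [accepted] gives equal sets without function
   extensionality. *)
suff -> : candidate I b = candidate I (tuple_of n0 l) by apply: maxA.
apply/setP => j; rewrite -!(accepted_candidate (b' := digit n l)) // => i.
by rewrite lb // /b' valK.
Qed.

End Solver.

Theorem theorem4p28 (R : realType) :
  exists (prog : cmd) (C n0 : nat),
    forall (d n : nat) (I : mdkp R d n),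
      has_equivalent_graph I ->
      exists (t : nat) (s : state R),
        exec prog (init_state I) t s /\
        optimal I (output n s) /\
        (n0 <= n -> t <= C * n ^ (2 * d + 1)).
Proof.
(* The threshold 2 gives [d <= n ^ d], which trades the factor [d] in the cost for [n ^ d]. At
   [n = 1] the power is 1 while the cost grows with [d]. *)
exists solver, 60, 2 => d n I /solver_correct[t [s [e le_t opt]]].
exists t, s; split=> //; split=> // n2; apply: leq_trans le_t _.
have d0 := dim_gt0 I; have le_d : d <= n ^ d by apply/ltnW/ltn_expl.
have -> : n ^ (2 * d + 1) = n ^ d * (n * n ^ d).
  by rewrite mulnA -expnSr -expnD; congr (n ^ _); lia.
(* 56 is 16 + 18 + 11 + 11, each term being at most its coefficient times [n * d]. The additive 4 of
   the total cost then turns 56 into 60. *)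
have body : n * (16 * d + 18) + 11 * d + 11 <= 56 * (n * d) by nia.
have pos : 0 < n ^ d * (n * d) by rewrite !muln_gt0 expn_gt0 d0 !(ltnW n2).
apply: (@leq_trans (n ^ d * (60 * (n * d)))); first by nia.
by rewrite mulnCA !leq_mul2l le_d !orbT.
Qed.
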